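(* Let $A = \langle\Sigma, Q_A, \to_A, Q_A^\circ\rangle$ and $B = \langle\Sigma, Q_B, \to_B, Q_B^\circ\rangle$ be automata, and let $n \in \mathbb{N}$ (with $0\in\mathbb N$). Then $$\mathrm{LC}^{n+1}(A,B) = \{\, (X_A,X_B) \in Q_A^{\det} \times Q_B^{\det} \mid (X_A,X_B,x_B) \notin \mathrm{MC}^n(A,B)\ \text{for some } x_B \in X_B \,\}.$$
   Context: **Automata.** $\Sigma$ is a finite alphabet, and $\tau,\omega\notin\Sigma$ are two special events (silent event, termination event). An automaton is $A=\langle\Sigma,Q,\to,Q^\circ\rangle$ with state set $Q$, transition relation $\to\subseteq Q\times(\Sigma\cup\{\tau,\omega\})\times Q$, initial states $Q^\circ\subseteq Q$, such that whenever $x\to^{\omega}y$, there is no outgoing transition from $y$. The relation $\to$ extends to finite traces as usual. For $s\in(\Sigma\cup\{\omega\})^*$, $x\Rightarrow^{s}y$ means $x\to^{t}y$ for some $t\in(\Sigma\cup\{\omega,\tau\})^*$ from which $s$ is obtained by deleting all $\tau$. For a state set $X$, $X\Rightarrow^{s}y$ means $x\Rightarrow^{s}y$ for some $x\in X$; $x\Rightarrow^{s}$ means $x\Rightarrow^{s}y$ for some $y$ (similarly for state sets). The marked language is $\mathcal L^\omega(x)=\{s\omega\mid s\in\Sigma^*,\ x\Rightarrow^{s\omega}\}$. $r\sqsubseteq s$ means that $r$ is a prefix of $s$. **Deterministic transition function.** $Q_A^{\det}=2^{Q_A}\cup\{\omega\}$, where $\omega$ is an extra symbol, regarded as having no elements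 (so ''$x_B\in X_B$'' is false when $X_B=\omega$). For $X\subseteq Q_A$: $\delta_A(X,\omega)=\omega$ if $X\Rightarrow^{\omega}$, and $\delta_A(X,\omega)=\emptyset$ otherwise; $\delta_A(X,\sigma)=\{y\in Q_A\mid X\Rightarrow^{\sigma}y\}$ for $\sigma\in\Sigma$; and $\delta_A(\omega,\sigma)=\emptyset$ for all $\sigma\in\Sigma\cup\{\omega\}$. Extend to traces in $\Sigma^*\cup\Sigma^*\omega$ by $\delta_A(X,\varepsilon)=X$ and $\delta_A(X,s\sigma)=\delta_A(\delta_A(X,s),\sigma)$. Put $\delta_{A,B}(X_A,X_B,s)=(\delta_A(X_A,s),\delta_B(X_B,s))$. **Less conflicting pairs.** The sets $\mathrm{LC}^n(A,B)\subseteq Q_A^{\det}\times Q_B^{\det}$ are defined inductively by - $\mathrm{LC}^0(A,B)=\{\omega\}\times Q_B^{\det}\ \cup\ \{(X_A,X_B)\mid X_B\subseteq Q_B$ and there is $x_B\in X_B$ with $\mathcal L^\omega(x_B)=\emptyset\}$; - $\mathrm{LC}^{n+1}(A,B)=\{(X_A,X_B)\mid$ there exists $x_B\in X_B$ such that for all $t\in\Sigma^*$, if $x_B\Rightarrow^{t\omega}$ then there exists $r\sqsubseteq t\omega$ such that $\delta_{A,B}(X_A,X_B,r)\in\mathrm{LC}^i(A,B)$ for some $i\le n\}$. **More conflicting triples.** $\mathrm{MC}^n(A,B)=\bigcup_{m\ge0}\mathrm{MC}^n_m(A,B)\subseteq Q_A^{\det}\times Q_B^{\det}\times Q_B$, where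 - $\mathrm{MC}^n_0(A,B)=\{(\emptyset,\omega,x_B)\mid x_B\in Q_B\}$; - $\mathrm{MC}^n_{m+1}(A,B)=\{(X_A,X_B,x_B)\mid (X_A,X_B)\notin\mathrm{LC}^n(A,B)$ and $x_B\in X_B$ and there exist $(Y_A,Y_B,y_B)\in\mathrm{MC}^n_m(A,B)$ and $\sigma\in\Sigma\cup\{\omega\}$ such that $\delta_{A,B}(X_A,X_B,\sigma)=(Y_A,Y_B)$ and $x_B\Rightarrow^{\sigma}y_B\}$. *)

(* Defs.v *)
From mathcomp Require Import all_boot.
From mathcomp Require Import boolp classical_sets.

Set Implicit Arguments.
Unset Strict Implicit.
Unset Printing Implicit Defensive.

Local Open Scope classical_set_scope.

(* [event Sigma] is Sigma together with omega; [label Sigma] adds tau. *)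
Definition event (Sigma : finType) : finType := option Sigma.
Definition label (Sigma : finType) : finType := option (event Sigma).

Definition omega {Sigma : finType} : event Sigma := None.
Definition act {Sigma : finType} (a : Sigma) : event Sigma := Some a.
Definition tau {Sigma : finType} : label Sigma := None.
Definition vis {Sigma : finType} (e : event Sigma) : label Sigma := Some e.

(* State spaces are arbitrary types: they need not be finite or inhabited. *)
Record automaton (Sigma : finType) := Automaton {
  state : Type;
  trans : state -> label Sigma -> state -> Prop;
  init : set state;
  omega_final : forall x y, trans x (vis omega) y ->
    forall (l : label Sigma) (z : state), ~ trans y l z
}.

Section Semantics.
Variables (Sigma : finType) (A : automaton Sigma).
Implicit Types (x y : state A) (X : set (state A)).

Fixpoint strong_trace x (t : seq (label Sigma)) y : Prop :=
  if t is l :: t' then exists2 z, trans x l z & strong_trace z t' y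
  else x = y.

(* Labels are options with tau = None, so this deletes every tau. *)
Definition delete_tau (t : seq (label Sigma)) : seq (event Sigma) :=
  pmap id t.

Definition weak_trace x (s : seq (event Sigma)) y : Prop :=
  exists2 t, strong_trace x t y & delete_tau t = s.

Definition weak_trace_set X (s : seq (event Sigma)) y : Prop :=
  exists2 x, X x & weak_trace x s y.

Definition terminated (t : seq Sigma) : seq (event Sigma) :=
  rcons (map act t) omega.

Definition marked_language x : set (seq (event Sigma)) :=
  [set u | exists t, u = terminated t /\ exists y, weak_trace x u y].

(* [Some X] is the state set X, and [None] is the extra symbol omega. *)
Definition det_state : Type := option (set (state A)).
Definition det_omega : det_state := None.
Definition det_set X : det_state := Some X.

Definition in_det x (D : det_state) : Prop :=
  if D is Some X then X x else False.

Definition delta (D : det_state) (e : event Sigma) : det_state :=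
  match D, e with
  | Some X, None =>
      if `[< exists y, weak_trace_set X [:: omega] y >] then det_omega
      else det_set set0
  | Some X, Some a => det_set [set y | weak_trace_set X [:: act a] y]
  | None, _ => det_set set0
  end.

(* Only used on traces in Sigma^* or Sigma^* omega. *)
Definition delta_trace (D : det_state) (s : seq (event Sigma)) : det_state :=
  foldl delta D s.

End Semantics.

Arguments det_omega {Sigma A}.

Section LessConflicting.
Variables (Sigma : finType) (A B : automaton Sigma).

Definition delta_pair (XA : det_state A) (XB : det_state B)
    (s : seq (event Sigma)) : det_state A * det_state B :=
  (delta_trace XA s, delta_trace XB s).

(* The recursive occurrence has a strictly smaller level (i <= n), so this
   inductive family is the one given by recursion on the level. *)
Inductive LC : nat -> det_state A * det_state B -> Prop :=
| LC_omega (XB : det_state B) : LC 0 (det_omega, XB)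
| LC_blocked (XA : det_state A) (XB : set (state B)) (xB : state B) :
    XB xB -> marked_language xB = set0 -> LC 0 (XA, det_set XB)
| LC_step (n : nat) (XA : det_state A) (XB : det_state B) (xB : state B) :
    in_det xB XB ->
    (forall t : seq Sigma,
       (exists y, weak_trace xB (terminated t) y) ->
       exists r : seq (event Sigma), prefix r (terminated t) /\
         exists i : nat, i <= n /\ LC i (delta_pair XA XB r)) ->
    LC n.+1 (XA, XB).

Fixpoint MC_at (n m : nat) : set (det_state A * det_state B * state B) :=
  if m is m'.+1 then
    [set T | exists XA XB xB,
      [/\ T = (XA, XB, xB), ~ LC n (XA, XB), in_det xB XB &
        exists YA YB yB (e : event Sigma),
          [/\ MC_at n m' (YA, YB, yB),
              delta_pair XA XB [:: e] = (YA, YB) &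
              weak_trace xB [:: e] yB]]]
  else [set T | exists xB, T = (det_set set0, det_omega, xB)].

Definition MC (n : nat) : set (det_state A * det_state B * state B) :=
  \bigcup_m MC_at n m.

End LessConflicting.

(* Main.v *)
(** A triple [(XA, XB, xB)] with [xB] in [XB] is more conflicting at level [n]
    iff [xB] weakly accepts some marked trace none of whose prefixes leads
    [(XA, XB)] into a level [i <= n] of [LC]. The theorem is the negation of
    this equivalence, quantified over [xB]. The definition of [MC] only excludes
    the single level [n]; this suffices because [LC] is monotone in the level on
    pairs whose second component has an element. *)
Require Import Defs.
From mathcomp Require Import all_boot.
From mathcomp Require Import boolp classical_sets.

Local Open Scope classical_set_scope.

Section WeakTraces.
Set Implicit Arguments.
Unset Strict Implicit.
Context {Sigma : finType} {A : automaton Sigma}.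
Implicit Types (x y z : state A) (D : det_state A).
Implicit Types (e : event Sigma) (s : seq (event Sigma)).

Lemma strong_trace_cat x t1 t2 y z :
  strong_trace x t1 y -> strong_trace y t2 z -> strong_trace x (t1 ++ t2) z.
Proof.
elim: t1 x => [|l t1 IHt] x /=; first by move->.
by case=> w xw wy yz; exists w => //; apply: IHt.
Qed.

Lemma weak_trace_cat x s1 s2 y z :
  weak_trace x s1 y -> weak_trace y s2 z -> weak_trace x (s1 ++ s2) z.
Proof.
case=> t1 xy <- [t2 yz <-]; exists (t1 ++ t2); last exact: pmap_cat.
exact: strong_trace_cat xy yz.
Qed.

(** The path is cut right after its first step other than [tau]. *)
Lemma weak_trace_cons_inv x e s z :
  weak_trace x (e :: s) z ->
  exists2 y, weak_trace x [:: e] y & weak_trace y s z.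
Proof.
case=> t; elim: t x => [|[f|] t IHt] x //= [w xw wz].
  case=> <- <-; exists w; last by exists t.
  by exists [:: vis f] => //; exists w.
case/(IHt _ wz) => y [u wy u_e] yz; exists y => //.
by exists (tau :: u) => //; exists w.
Qed.

Lemma in_det_delta_act D x y a :
  in_det x D -> weak_trace x [:: act a] y -> in_det y (delta D (act a)).
Proof. by case: D => //= X Xx xy; exists x. Qed.

Lemma delta_omega_accept D x y :
  in_det x D -> weak_trace x [:: omega] y -> delta D omega = det_omega.
Proof.
by case: D => //= X Xx xy; case: asboolP => // -[]; exists y, x.
Qed.

Lemma delta_omegaP D :
  delta D omega = det_omega \/ delta D omega = det_set set0.
Proof. by case: D => [X|] /=; [case: ifP; [left|right] | right]. Qed.

Lemma not_in_det_delta_omega x D : ~ in_det x (delta D omega).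
Proof. by case: (delta_omegaP D) => ->. Qed.

End WeakTraces.

Section Conflict.
Set Implicit Arguments.
Unset Strict Implicit.
Context {Sigma : finType} {A B : automaton Sigma}.
Implicit Types (XA : det_state A) (XB : det_state B) (xB : state B).

(** Level 0 pairs pass the test of [LC_step]: with [det_omega] on the left the empty prefix already
    succeeds, and a blocked state has no marked trace to test. The element [xB] serves as the
    witness that [LC_step] demands in the first case, since [LC_omega] supplies none. *)
Lemma LC_monotone i n XA XB xB :
  in_det xB XB -> i <= n -> LC i (XA, XB) -> LC n (XA, XB).
Proof.
move=> XBx le_in LCi; case: n le_in => [|n] le_in.
  by move: le_in LCi; rewrite leqn0 => /eqP ->.
move eqP: (XA, XB) LCi => P LCi.
case: LCi eqP le_in => [YB|YA YB yB YBy blocked|k YA YB yB YBy LCk] [eA eB] le_in.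
- subst XA YB; apply: (LC_step XBx) => t _; exists [::]; split; first exact: prefix0s.
  by exists 0; split=> //; apply: LC_omega.
- subst XA XB; apply: (@LC_step _ _ _ n YA (det_set YB) yB) => // t [y ty].
  have : marked_language yB (terminated t) by exists t; split=> //; exists y.
  by rewrite blocked.
- subst XA XB; apply: (LC_step YBy) => t /LCk [r [rt [j [jk LCj]]]].
  by exists r; split=> //; exists j; split=> //; apply: leq_trans jk _.
Qed.

(** This is the pair at which every [MC_at] chain ends. [LC_omega] needs [det_omega] on the left,
    and the other constructors need an element on the right. *)
Lemma not_LC_set0_omega i : ~ LC i (@det_set _ A set0, @det_omega _ B).
Proof.
move eqP: (det_set set0, det_omega) => P LCi.
by case: LCi eqP => [YB|YA YB yB _ _|k YA YB yB YBy _] [] // _ eB; subst YB.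
Qed.

(** At [terminated t], this negates what [LC_step] asks of the trace [t]. *)
Definition avoids_LC n XA XB (s : seq (event Sigma)) : Prop :=
  forall r, prefix r s -> forall i, i <= n -> ~ LC i (delta_pair XA XB r).

Lemma avoids_LC_cons n XA XB e s :
  avoids_LC n XA XB (e :: s) <->
  (forall i, i <= n -> ~ LC i (XA, XB)) /\
  avoids_LC n (delta XA e) (delta XB e) s.
Proof.
split=> [av|[av0 av] [|f r]]; [split=> [|r rs]| |].
- exact: (av [::]).
- by apply: (av (e :: r)); rewrite prefix_cons eqxx.
- by move=> _; apply: av0.
- by rewrite prefix_cons => /andP[/eqP -> /av].
Qed.

(** The trace is read off the events along the [MC_at] chain. Membership of [xB] excludes the base
    triples, so the chain has at least one step. *)
Lemma MC_at_accept n m XA XB xB :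
  MC_at n m (XA, XB, xB) -> in_det xB XB ->
  exists2 t, (exists y, weak_trace xB (terminated t) y) &
             avoids_LC n XA XB (terminated t).
Proof.
elim: m XA XB xB => [|m IHm] XA XB xB /=; first by case=> _ [_ -> _].
case=> _ [_ [_ [[<- <- <-] nLC XBx [YA [YB [yB [e [MCm [eA eB] xy]]]]]]]] _.
have avX i : i <= n -> ~ LC i (XA, XB) by move=> le_in /(LC_monotone XBx le_in).
rewrite -{}eA -{}eB in MCm.
case: e xy MCm => [a|] xy MCm.
  have [t [z yz] av] := IHm _ _ _ MCm (in_det_delta_act XBx xy).
  exists (a :: t); last by apply/avoids_LC_cons.
  by exists z; apply: weak_trace_cat xy yz.
exists [::]; first by exists yB.
apply/avoids_LC_cons; split=> // r; rewrite prefixs0 => /eqP -> i _.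
(* After [omega] the right component has no elements, so the chain must end here, at a base
   triple. *)
case: m {IHm} MCm => [|m] /=; last first.
  by case=> ZA [ZB [zB [[_ <- _] _ /(@not_in_det_delta_omega _ B)]]].
by rewrite /delta_pair /= => -[_ [-> -> _]]; apply: not_LC_set0_omega.
Qed.

Lemma accept_MC n t XA XB xB y :
  in_det xB XB -> weak_trace xB (terminated t) y ->
  avoids_LC n XA XB (terminated t) -> MC n (XA, XB, xB).
Proof.
elim: t XA XB xB => [|a t IHt] XA XB xB XBx xy /avoids_LC_cons[avX av].
  exists 1 => //; exists XA, XB, xB; split=> //; first exact: avX.
  exists (det_set set0), det_omega, y, omega; split=> //; first by exists y.
  congr (_, _); last exact: delta_omega_accept XBx xy.
  (* If [XA] could also terminate, [LC_omega] would put the successor pair into level 0, against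
     avoidance. *)
  case: (delta_omegaP XA) => // eA.
  by case: (av [::] isT 0 isT); rewrite eA; apply: LC_omega.
have [z xz zy] := weak_trace_cons_inv xy.
have [m _ MCm] := IHt _ _ _ (in_det_delta_act XBx xz) zy av.
exists m.+1 => //; exists XA, XB, xB; split=> //; first exact: avX.
by exists (delta XA (act a)), (delta XB (act a)), z, (act a).
Qed.

End Conflict.

Theorem theorem6 (Sigma : finType) (A B : automaton Sigma) (n : nat) :
  @LC Sigma A B n.+1 =
  [set P : det_state A * det_state B |
    exists xB : state B, in_det xB P.2 /\ ~ @MC Sigma A B n (P.1, P.2, xB)].
Proof.
apply/predeqP => -[XA XB] /=; split=> [LCn|[xB [XBx nMC]]].
  move eqk: n.+1 LCn => k; move eqP: (XA, XB) => P LCk.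
  case: LCk eqk eqP => // k' YA YB xB YBx LCn [en] [eA eB].
  (* The witness of [LC_step] is reused: a trace obtained from [MC] would both avoid [LC] and have a
     prefix reaching it. *)
  subst k' YA YB; exists xB; split=> // -[m _ /MC_at_accept/(_ YBx)[t /LCn[r [rt [i [le_in LCi]]]]]].
  by move/(_ r rt i le_in).
apply: (LC_step XBx) => t [y xy].
apply: contrapT => nLC; apply: nMC; apply: (accept_MC XBx xy) => r rt i le_in LCi.
by apply: nLC; exists r; split=> //; exists i.
Qed.
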